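(* Consider a location model $p_\theta(x)=p(x-\theta)$, $x\in\mathbb R$, $\theta\in\Theta\subset\mathbb R$, for a given density $p$ on $\mathbb R$, and the Cressie-Read divergence with index $\gamma\in\mathbb R$. Let $\alpha,\theta_0\in\Theta$. If $$\sup_x\left|\left(\frac{p(x-\alpha)}{p(x-\theta_0)}\right)^{\gamma}\frac{\partial}{\partial\theta}\log p(x-\theta_0)\right|<\infty,$$ where $\frac{\partial}{\partial\theta}\log p(x-\theta_0)$ denotes the derivative of $\theta\mapsto\log p(x-\theta)$ at $\theta=\theta_0$, then the dual $\phi$-divergence estimator $\widehat\theta_n(\alpha)$ is B-robust, i.e. $\sup_x|\mathrm{IF}(x;T_\alpha,P_{\theta_0})|<\infty$.
   Context: Cressie-Read divergences: for $\gamma\in\mathbb R\setminus\{0,1\}$, $\varphi_\gamma(x)=\frac{x^\gamma-\gamma x+\gamma-1}{\gamma(\gamma-1)}$ for $x>0$; $\varphi_0(x)=-\log x+x-1$; $\varphi_1(x)=x\log x-x+1$. Let $\varphi=\varphi_\gamma$. $P_\theta$ is the probability measure with density $p_\theta$ (with respect to Lebesgue measure), the model is identifiable, and $\theta_0$ is the true parameter value. Put $$m(\theta,\alpha,x)=\int\varphi'\left(\frac{p_\alpha}{p_\theta}\right)dP_\alpha-\left\{\varphi'\left(\frac{p_\alpha(x)}{p_\theta(x)}\right)\frac{p_\alpha(x)}{p_\theta(x)}-\varphi\left(\frac{p_\alpha(x)}{p_\theta(x)}\right)\right\}.$$ For every $\alpha$, $\theta\mapsto\int m(\theta,\alpha)\,dP_{\theta_0}$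 has the unique maximizer $\theta_0$. With $P_n$ the empirical measure of an i.i.d. sample, $\widehat\theta_n(\alpha)=\arg\sup_{\theta\in\Theta}\int m(\theta,\alpha)\,dP_n$, and the corresponding functional is $T_\alpha(P)=\arg\sup_{\theta\in\Theta}\int m(\theta,\alpha,y)\,dP(y)$. Standing assumptions (with $m',m''$ the first and second derivatives of $m$ in $\theta$): for each $\alpha$, $\theta\mapsto m(\theta,\alpha)$ is twice continuously differentiable; $\int m''(\theta_0,\alpha)\,dP_{\theta_0}$ exists and is non-zero; and the first and second derivatives of $\theta\mapsto m(\theta,\alpha)$ are dominated on some neighborhoods of $\theta_0$ by $P_{\theta_0}$-integrable functions (which justifies interchanging differentiation in $\theta$ and integration). The influence function of a functional $T$ at $P$ is $\mathrm{IF}(x;T,P)=\lim_{\varepsilon\to0}\frac{T((1-\varepsilon)P+\varepsilon\delta_x)-T(P)}{\varepsilon}$, with $\delta_x$ the Dirac measure at $x$. An estimator with functional $T$ is called B-robust if its gross error sensitivity $\sup_x\|\mathrm{IF}(x;T,P)\|$ is finite (here at $P=P_{\theta_0}$). *)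

(* Defs.v *)
From mathcomp Require Import all_boot all_order all_algebra.
From mathcomp Require Import all_classical all_reals all_analysis.

Set Implicit Arguments.
Unset Strict Implicit.
Unset Printing Implicit Defensive.

Import Order.TTheory GRing.Theory Num.Theory.
Import numFieldNormedType.Exports.

Local Open Scope classical_set_scope.
Local Open Scope ring_scope.

(** The formula is the intended one for [0 < x] only: [ln] and [powR] take
    default values on nonpositive arguments. *)
Definition cressie_read {R : realType} (g : R) (x : R) : R :=
  if g == 0 then - ln x + x - 1
  else if g == 1 then x * ln x - x + 1
  else (x `^ g - g * x + g - 1) / (g * (g - 1)).

Definition is_density {R : realType} (p : R -> R) : Prop :=
  [/\ measurable_fun [set: R] p, (forall x, 0 <= p x) &
      (\int[lebesgue_measure]_(x in [set: R]) (p x)%:E = 1)%E].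

Definition is_location_model {R : realType} (p : R -> R) (Theta : set R)
    (P : R -> probability (measurableTypeR R) R) : Prop :=
  forall theta, Theta theta -> forall A : set (measurableTypeR R), measurable A ->
    (P theta A = \int[lebesgue_measure]_(x in A) (p (x - theta))%:E)%E.

Definition identifiable {R : realType} (Theta : set R)
    (P : R -> probability (measurableTypeR R) R) : Prop :=
  forall t1 t2, Theta t1 -> Theta t2 ->
    (forall A : set (measurableTypeR R), measurable A -> P t1 A = P t2 A) ->
    t1 = t2.

Definition density_ratio {R : realType} (p : R -> R) (alpha theta x : R) : R :=
  p (x - alpha) / p (x - theta).

(** [fine] (inside the real-valued integral) sends an infinite integral to 0;
    this is harmless when [derive1 phi \o density_ratio p alpha theta] is
    integrable with respect to [P alpha]. *)
Definition m_fun {R : realType} (phi p : R -> R)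
    (P : R -> probability (measurableTypeR R) R) (theta alpha x : R) : R :=
  (\int[P alpha]_(y in [set: R]) derive1 phi (density_ratio p alpha theta y))
  - (derive1 phi (density_ratio p alpha theta x) * density_ratio p alpha theta x
     - phi (density_ratio p alpha theta x)).

(** The integral is extended-real-valued; it is [-oo] when neither the positive
    nor the negative part is integrable, so that such a [theta] never competes
    in the maximization. *)
Definition criterion {R : realType} (phi p : R -> R)
    (P : R -> probability (measurableTypeR R) R) (alpha : R)
    (Q : {measure set (measurableTypeR R) -> \bar R}) (theta : R) : \bar R :=
  (\int[Q]_(x in [set: R]) (m_fun phi p P theta alpha x)%:E)%E.

Definition argsup {R : realType} (Theta : set R) (f : R -> \bar R) : set R :=
  [set t | Theta t /\ forall theta, Theta theta -> (f theta <= f t)%E].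

(** [T] may be any selection of maximizers; its values at measures whose
    criterion has no maximizer are irrelevant. *)
Definition is_dual_functional {R : realType} (phi p : R -> R)
    (P : R -> probability (measurableTypeR R) R) (Theta : set R) (alpha : R)
    (T : {measure set (measurableTypeR R) -> \bar R} -> R) : Prop :=
  forall Q : {measure set (measurableTypeR R) -> \bar R},
    argsup Theta (criterion phi p P alpha Q) !=set0 ->
    argsup Theta (criterion phi p P alpha Q) (T Q).

(** [(1 - e) Q + e delta_x]; the absolute values only make the definition total
    in [e], they disappear for [0 <= e <= 1]. *)
Definition contamination {R : realType}
    (Q : {measure set (measurableTypeR R) -> \bar R}) (x e : R) :
    {measure set (measurableTypeR R) -> \bar R} :=
  measure_add (mscale (NngNum (normr_ge0 (1 - e))) Q)
    (mscale (NngNum (normr_ge0 e)) (dirac (x : measurableTypeR R))).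

Definition influence_quotient {R : realType}
    (T : {measure set (measurableTypeR R) -> \bar R} -> R)
    (Q : {measure set (measurableTypeR R) -> \bar R}) (x e : R) : R :=
  (T (contamination Q x e) - T Q) / e.

(** The limit is one-sided: the contaminated measure is a probability measure
    only for [0 <= e <= 1]. *)
Definition influence_function {R : realType}
    (T : {measure set (measurableTypeR R) -> \bar R} -> R)
    (Q : {measure set (measurableTypeR R) -> \bar R}) (x : R) : R :=
  lim (influence_quotient T Q x e @[e --> 0^'+]).

Definition gross_error_sensitivity {R : realType}
    (T : {measure set (measurableTypeR R) -> \bar R} -> R)
    (Q : {measure set (measurableTypeR R) -> \bar R}) : \bar R :=
  ereal_sup (range (fun x : R => `|influence_function T Q x|%:E)).

(** [lim] is a total operator, hence the explicit existence clause. *)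
Definition B_robust {R : realType}
    (T : {measure set (measurableTypeR R) -> \bar R} -> R)
    (Q : {measure set (measurableTypeR R) -> \bar R}) : Prop :=
  (forall x : R, cvg (influence_quotient T Q x e @[e --> 0^'+])) /\
  (gross_error_sensitivity T Q < +oo)%E.

Definition twice_continuously_differentiable {R : realType} (D : set R)
    (f : R -> R) : Prop :=
  forall t, D t ->
    [/\ derivable f t 1, derivable (derive1 f) t 1 & {for t, continuous (derive1n 2 f)}].

Definition dominated_near {R : realType} (t0 : R)
    (Q : {measure set (measurableTypeR R) -> \bar R}) (f : R -> R -> R) : Prop :=
  exists2 h : R -> R, Q.-integrable [set: R] (EFin \o h) &
    \forall t \near t0, forall x, `|f t x| <= h x.

(* Main.v *)
Require Import Defs.
From mathcomp Require Import all_boot all_order all_algebra.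
From mathcomp Require Import all_classical all_reals all_analysis.
From mathcomp Require Import measurable_realfun ring lra.

Import Order.TTheory GRing.Theory Num.Theory.
Import numFieldNormedType.Exports.

Local Open Scope classical_set_scope.
Local Open Scope ring_scope.

(** Write L_a for the primitive of [t `^ (a - 1)] that vanishes at 1, that is
    (t^a - 1) / a, or ln t when a = 0. The Cressie-Read divergence phi of index
    g satisfies phi' = L_(g-1) and t phi'(t) - phi(t) = L_g(t), so that
    m(theta, alpha, x) = C(theta) - L_g(r_theta(x)) with r_theta the density
    ratio p_alpha / p_theta and C(theta) the integral of L_(g-1)(r_theta)
    under P_alpha. All values of g, including 0 and 1, are thus treated alike.

    Boundedness. If the influence function is the usual one of an M-estimator,
    - m'(theta0, alpha, x) / E[m''(theta0, alpha)], then it remains to bound m'.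
    As L_g'(r) = r^(g-1) and the derivative of ln r_theta is minus the score,
    m'(theta0, alpha, x) = C'(theta0) + r^g * score: a constant plus the
    quantity assumed bounded ([derive1_m_fun]).

    Existence of the influence function. Let theta_e maximize the criterion at
    the contaminated measure. Once theta_e is known to tend to theta0, the
    first-order condition (1 - e) E[m'(theta_e)] + e m'(theta_e, x) = 0 and the
    differentiability of theta |-> E[m'(theta)] at theta0, where it vanishes
    with a nonzero derivative, give the limit of (theta_e - theta0) / e
    ([cvg_implicit_slope], [m_estimator_influence]).

    Consistency is the delicate point: Theta need not be compact, and m need not
    be bounded, or even continuous, away from theta0. Two facts replace
    compactness. First, with M(theta) = E[m(theta)], the maximal value of
    (1 - e) M + e m(., x) is a convex function of e, finite at some e1 > 0, which
    forces M(theta_e) to tend to M(theta0) ([perturbed_argmax_cvg]). Second,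
    theta0 is a well-separated maximizer of M ([dual_criterion_separated]).
    Indeed M(theta0) - M(theta) is the expected Bregman divergence of phi between
    r_theta0 and r_theta, and by homogeneity it equals the integral under
    P_theta0 of r_theta0^g * (L_g - L_(g-1))(p_theta0 / p_theta)
    ([dual_criterion_gap]). The gap L_g - L_(g-1) is nonnegative and increases
    from 0 on [1, +oo[; hence if M(theta) is close to M(theta0), then p_theta0 is
    rarely much larger than p_theta under P_theta0, so that P_theta(A) is at
    least almost P_theta0(A) for every event A
    ([integral_dlog_gap_lbound]). In a location model with positive density, a
    shift by at least delta lowers the probability of one of the half-lines
    ]-oo, theta0] and [theta0, +oo[ by a fixed amount
    ([location_separation]), and theta has to be within delta of theta0. *)

(** * Cressie-Read functions through deformed logarithms *)

(** The primitive of [t `^ (a - 1)] vanishing at 1; the case [a = 0] is the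
    limit of the generic formula. *)
Definition dlog {R : realType} (a t : R) : R :=
  if a == 0 then ln t else (t `^ a - 1) / a.

Lemma is_derive_dlog {R : realType} (a t : R) : 0 < t ->
  is_derive t 1 (dlog a) (t `^ (a - 1)).
Proof.
move=> t0; rewrite /dlog; case: (eqVneq a 0) => [->|a0].
  by rewrite sub0r powR_inv1 ?(ltW t0)//; exact: is_derive1_ln.
have -> : (fun x : R => (x `^ a - 1) / a) = a^-1 *: ((fun x : R => x `^ a) - cst 1).
  by apply/funext => x /=; rewrite !fctE mulrC.
have h := @is_derive1_powR _ a _ t0.
apply: is_derive_eq.
by rewrite subr0 /GRing.scale /= mulrA mulVf// mul1r.
Qed.

Lemma measurable_dlog {R : realType} (a : R) :
  measurable_fun [set: R] (dlog a).
Proof.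
rewrite /dlog; case: (eqVneq a 0) => [_|a0]; first exact: measurable_ln.
by apply: measurable_funM => //; apply: measurable_funB => //.
Qed.

Lemma dlog1 {R : realType} (a : R) : dlog a 1 = 0.
Proof.
by rewrite /dlog; case: ifP => _; [exact: ln1|rewrite powR1 subrr mul0r].
Qed.

(** The deformed addition formula is what makes the Bregman divergence of a
    Cressie-Read function homogeneous. *)
Lemma dlogM {R : realType} (a s t : R) : 0 < s -> 0 < t ->
  dlog a (s * t) = dlog a s + s `^ a * dlog a t.
Proof.
move=> s0 t0; rewrite /dlog; case: (eqVneq a 0) => [->|a0].
  by rewrite lnM ?posrE// powRr0 mul1r.
by rewrite powRM ?(ltW s0) ?(ltW t0)//; field.
Qed.

Lemma powRS {R : realType} (a s : R) : 0 < s -> s * s `^ (a - 1) = s `^ a.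
Proof.
move=> s0; rewrite -{1}(powRr1 (ltW s0)) -powRD; last by rewrite (gt_eqF s0) implybT.
by rewrite addrC subrK.
Qed.

Lemma derive1_cressie_read {R : realType} (g t : R) : 0 < t ->
  derive1 (cressie_read g) t = dlog (g - 1) t.
Proof.
move=> t0; rewrite derive1E; apply: derive_val.
have hp := @is_derive1_powR _ g _ t0.
have hl := is_derive1_ln t0.
rewrite /cressie_read /dlog subr_eq0; case: (eqVneq g 0) => [->|g0].
  rewrite eq_sym oner_eq0.
  have -> : (fun x : R => - ln x + x - 1) = - @ln R + id - cst 1 by [].
  apply: is_derive_eq.
  rewrite sub0r powR_inv1 ?(ltW t0)//.
  by field; rewrite gt_eqF.
case: (eqVneq g 1) => [_|g1].
  have -> : (fun x : R => x * ln x - x + 1) = (id * @ln R) - id + cst 1 by [].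
  apply: is_derive_eq.
  rewrite /GRing.scale /= addr0 mulr1 mulfV ?gt_eqF//; ring.
have -> : (fun x : R => (x `^ g - g * x + g - 1) / (g * (g - 1))) =
   (g * (g - 1))^-1 *: ((fun x : R => x `^ g) - g *: id + cst g - cst 1).
  by apply/funext => x /=; rewrite !fctE mulrC.
apply: is_derive_eq; rewrite /GRing.scale /=.
by field; rewrite g0 subr_eq0 g1.
Qed.

Lemma cressie_read_conjugate {R : realType} (g t : R) : 0 < t ->
  derive1 (cressie_read g) t * t - cressie_read g t = dlog g t.
Proof.
move=> t0; rewrite derive1_cressie_read// /dlog /cressie_read subr_eq0.
have /= := powRS g t t0.
case: (eqVneq g 0) => [->|g0].
  rewrite eq_sym oner_eq0 sub0r powR_inv1 ?(ltW t0)// => _.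
  by field; rewrite gt_eqF.
case: (eqVneq g 1) => [->|g1].
  by rewrite powRr1 ?(ltW t0)// => _; field.
move=> <-.
by field; rewrite g0 subr_eq0 g1.
Qed.

(** The Bregman divergence phi(1) - phi(t) - phi'(t) (1 - t) of the Cressie-Read
    function phi of index [g]; its sections through points other than 1 follow
    from this one by [dlogM]. *)
Definition dlog_gap {R : realType} (g t : R) : R := dlog g t - dlog (g - 1) t.

Lemma is_derive_dlog_gap {R : realType} (g t : R) : 0 < t ->
  is_derive t 1 (dlog_gap g) (t `^ (g - 2) * (t - 1)).
Proof.
move=> t0; have h1 := is_derive_dlog g t t0.
have h2 := is_derive_dlog (g - 1) t t0.
have -> : dlog_gap g = dlog g - dlog (g - 1) by [].
apply: is_derive_eq.
rewrite -(powRS (g - 1) t t0) (_ : g - 1 - 1 = g - 2); ring.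
Qed.

Lemma dlog_gap_lt {R : realType} (g a b : R) :
  1 <= a -> a < b -> dlog_gap g a < dlog_gap g b.
Proof.
move=> a1 ab.
have d x : a <= x -> is_derive x 1 (dlog_gap g) (x `^ (g - 2) * (x - 1)).
  move=> ax; apply: is_derive_dlog_gap.
  exact: lt_le_trans ltr01 (le_trans a1 ax).
apply: (@gtr0_derive1_lt_cc _ (dlog_gap g) a b) => //.
- move=> x; rewrite in_itv/= => /andP[ax _].
  by have h := d _ (ltW ax); exact: ex_derive.
- move=> x; rewrite in_itv/= => /andP[ax _].
  have h := d _ (ltW ax); rewrite derive1E derive_val.
  have x1 := le_lt_trans a1 ax.
  by rewrite mulr_gt0 ?powR_gt0 ?subr_gt0// (lt_trans ltr01).
- apply: derivable_within_continuous => x; rewrite in_itv/= => /andP[ax _].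
  by have h := d _ ax; exact: ex_derive.
- by rewrite in_itv/= lexx ltW.
- by rewrite in_itv/= lexx ltW.
Qed.

Lemma dlog_gap1 {R : realType} (g : R) : dlog_gap g 1 = 0.
Proof. by rewrite /dlog_gap !dlog1 subrr. Qed.

(** The derivative has the sign of [t - 1], so the minimum is at 1. *)
Lemma dlog_gap_ge0 {R : realType} (g t : R) : 0 < t -> 0 <= dlog_gap g t.
Proof.
move=> t0; rewrite -[leLHS](dlog_gap1 g).
have [t1|t1|<-//] := ltgtP 1 t; first exact/ltW/dlog_gap_lt.
have d x : t <= x -> is_derive x 1 (dlog_gap g) (x `^ (g - 2) * (x - 1)).
  by move=> tx; apply: is_derive_dlog_gap; exact: lt_le_trans t0 tx.
apply: (@ler0_derive1_le_cc _ (dlog_gap g) t 1) => //.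
- move=> x; rewrite in_itv/= => /andP[tx _].
  by have h := d _ (ltW tx); exact: ex_derive.
- move=> x; rewrite in_itv/= => /andP[tx x1].
  have h := d _ (ltW tx); rewrite derive1E derive_val.
  by rewrite mulr_ge0_le0 ?powR_ge0// subr_le0 ltW.
- apply: derivable_within_continuous => x; rewrite in_itv/= => /andP[tx _].
  by have h := d _ tx; exact: ex_derive.
- by rewrite in_itv/= lexx ltW.
- by rewrite in_itv/= lexx ltW.
- exact: ltW.
Qed.

(** * Densities and location models *)

Lemma measurable_div {d : measure_display} {T : measurableType d}
    {R : realType} (p q : T -> R) :
  measurable_fun [set: T] p -> measurable_fun [set: T] q ->
  (forall x, 0 < q x) -> measurable_fun [set: T] (fun x => p x / q x).
Proof.
move=> mp mq q0.
have -> : (fun x => p x / q x) = (fun x => p x * q x `^ (-1)).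
  by apply/funext => x; rewrite powR_inv1// ltW.
apply: measurable_funM => //.
by apply: (measurableT_comp (measurable_powR _) mq).
Qed.

Lemma ge0_integral_density {d : measure_display} {T : measurableType d}
    {R : realType} (mu : {sigma_finite_measure set T -> \bar R})
    (nu : {finite_measure set T -> \bar R}) (q : T -> R) (f : T -> \bar R) :
  measurable_fun [set: T] q -> (forall x, 0 <= q x) ->
  (forall A, measurable A -> nu A = \int[mu]_(x in A) (q x)%:E)%E ->
  measurable_fun [set: T] f -> (forall x, 0 <= f x)%E ->
  (\int[nu]_x f x = \int[mu]_x (f x * (q x)%:E))%E.
Proof.
move=> mq q0 nuq mf f0.
have numu : nu `<< mu.
  apply/null_content_dominatesP => A mA muA0; rewrite nuq//.
  by apply: null_set_integral => //; apply/measurable_EFinP/measurable_funTS.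
rewrite -(Radon_Nikodym_SigmaFinite.change_of_variables numu)//.
have hq : ae_eq mu [set: T] (Radon_Nikodym_SigmaFinite.f nu mu) (EFin \o q).
  apply: integral_ae_eq => //.
  - exact: Radon_Nikodym_SigmaFinite.f_integrable.
  - exact/measurable_EFinP.
  - move=> E _ mE; rewrite -Radon_Nikodym_SigmaFinite.f_integral// nuq//.
apply: ae_eq_integral => //.
- apply: emeasurable_funM => //.
  exact: measurable_int (Radon_Nikodym_SigmaFinite.f_integrable numu).
- by apply: emeasurable_funM => //; exact/measurable_EFinP.
- exact: ae_eqe_mul2l.
Qed.

(** Change of measure between two laws dominated by [mu]: positivity of [q]
    makes [p / q] the density of [P] with respect to [Q]. *)
Lemma integral_density_ratio {d : measure_display} {T : measurableType d}
    {R : realType} (mu : {sigma_finite_measure set T -> \bar R})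
    (P Q : {finite_measure set T -> \bar R}) (p q : T -> R) (f : T -> R) :
  measurable_fun [set: T] p -> measurable_fun [set: T] q ->
  (forall x, 0 <= p x) -> (forall x, 0 < q x) ->
  (forall A, measurable A -> P A = \int[mu]_(x in A) (p x)%:E)%E ->
  (forall A, measurable A -> Q A = \int[mu]_(x in A) (q x)%:E)%E ->
  P.-integrable [set: T] (EFin \o f) ->
  Q.-integrable [set: T] (EFin \o (fun x => f x * (p x / q x))) /\
  (\int[Q]_x (f x * (p x / q x))%:E = \int[P]_x (f x)%:E)%E.
Proof.
move=> mp mq p0 q0 Pp Qq If.
have mpq : measurable_fun [set: T] (fun x => p x / q x) by exact: measurable_div.
have mf : measurable_fun [set: T] f by apply/measurable_EFinP/measurable_int/If.
have pq0 x : 0 <= p x / q x by rewrite divr_ge0// ltW.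
have ge0E (g : T -> \bar R) : measurable_fun [set: T] g ->
    (forall x, 0 <= g x)%E ->
    (\int[Q]_x (g x * (p x / q x)%:E) = \int[P]_x g x)%E.
  move=> mg g0.
  rewrite (ge0_integral_density mu P p)// (ge0_integral_density mu Q q)//.
  - by apply: eq_integral => x _; rewrite -muleA -EFinM divfK// gt_eqF.
  - by move=> x; exact: ltW.
  - by apply: emeasurable_funM => //; exact/measurable_EFinP.
  - by move=> x; rewrite mule_ge0// lee_fin.
have mfpq : measurable_fun [set: T] (fun x => f x * (p x / q x)).
  exact: measurable_funM.
split.
  apply/integrableP; split; first exact/measurable_EFinP.
  have /integrableP[_] := If; congr (_ < _)%E; rewrite -ge0E//.
    by apply: eq_integral => x _ /=; rewrite normrM (ger0_norm (pq0 x)).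
  by apply: measurableT_comp => //; exact/measurable_EFinP.
rewrite [LHS]integralE [RHS]integralE; congr (_ - _)%E.
- rewrite -ge0E//; last exact/measurable_funepos/measurable_EFinP.
  apply: eq_integral => x _; rewrite !funeposE -!EFin_max -EFinM.
  by rewrite maxr_pMl// mul0r.
- rewrite -ge0E//; last exact/measurable_funeneg/measurable_EFinP.
  apply: eq_integral => x _; rewrite !funenegE -!EFinN -!EFin_max -EFinM.
  by rewrite maxr_pMl// mul0r mulNr.
Qed.

Lemma lebesgue_measure_translation {R : realType} (h : R)
    (A : set (measurableTypeR R)) : measurable A ->
  pushforward lebesgue_measure
    ((fun x : measurableTypeR R => x - h) : _ -> measurableTypeR R) A =
  lebesgue_measure A.
Proof.
move=> mA; apply/esym/lebesgue_measure_unique => //=; first exact: measurable_funB.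
move=> _ _ [[a b]] _ <-.
rewrite /pushforward.
have -> : (fun x : R => x - h) @^-1` `]a, b] = `]a + h, b + h]%classic.
  by apply/seteqP; split => x /=; rewrite !in_itv/= ltrBrDr lerBlDr.
by rewrite !lebesgue_measure_itv/= !lte_fin ltrD2r -!EFinB opprD addrACA subrr addr0.
Qed.

(** Only measurability of the integrand is available here, so the change of
    variable comes from the invariance of the measure rather than from
    differential calculus. *)
Lemma ge0_integral_translation {R : realType} (h : R) (f : R -> \bar R)
    (D : set R) : measurable D -> measurable_fun D f -> (forall x, 0 <= f x)%E ->
  (\int[lebesgue_measure]_(x in (fun x : R => (x - h)%R) @^-1` D) f (x - h)%R =
   \int[lebesgue_measure]_(x in D) f x)%E.
Proof.
move=> mD mf f0.
have mh : measurable_fun [set: measurableTypeR R]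
    ((fun x : measurableTypeR R => x - h) : _ -> measurableTypeR R).
  exact: measurable_funB.
rewrite -[LHS](ge0_integral_pushforward mh lebesgue_measure mD mf)//.
by apply: eq_measure_integral => A mA _; exact: lebesgue_measure_translation.
Qed.

Lemma lt_integral_subset {d : measure_display} {T : measurableType d}
    {R : realType} (mu : {measure set T -> \bar R}) (f : T -> R) (A B : set T) :
  measurable A -> measurable B -> A `<=` B -> (0 < mu (B `\` A))%E ->
  (forall x, 0 < f x) -> mu.-integrable [set: T] (EFin \o f) ->
  (\int[mu]_(x in A) (f x)%:E < \int[mu]_(x in B) (f x)%:E)%E.
Proof.
move=> mA mB AB BA0 f0 intf.
have mf : measurable_fun [set: T] (EFin \o f) := measurable_int _ intf.
have mBA : measurable (B `\` A) by exact: measurableD.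
have -> : B = A `|` (B `\` A).
  by rewrite setDUK.
rewrite ge0_integral_setU//; last 3 first.
- exact: measurable_funTS.
- by move=> x _; rewrite lee_fin ltW.
- by rewrite disj_set2E; apply/eqP; exact: setDIK.
rewrite lteDl.
  rewrite lt_neqAle integral_ge0 ?andbT; last by move=> x _; rewrite lee_fin ltW.
  apply/negP => /eqP h.
  move: BA0; rewrite lt_neqAle => /andP[/negP + _]; apply; apply/eqP/esym.
  have /(ae_eq_integral_abs mu mBA (measurable_funTS mf)) :
      (\int[mu]_(x in B `\` A) `|(EFin \o f) x| = 0)%E.
    rewrite [RHS]h; apply: eq_integral => x _ /=.
    by rewrite ger0_norm// ltW.
  move=> [N [mN N0 sub]]; apply: (subset_measure0 mBA mN) => // x BAx.
  apply: sub => /= /(_ BAx) [] fx0.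
  by have := f0 x; rewrite fx0 ltxx.
apply: integrable_fin_num => //.
exact: integrableS intf.
Qed.

Lemma location_halfline {R : realType} (p : R -> R) (Theta : set R)
    (P : R -> probability (measurableTypeR R) R) (t c : R) :
  is_density p -> is_location_model p Theta P -> Theta t ->
  (P t `]-oo, c]%classic = \int[lebesgue_measure]_(y in `]-oo, (c - t)%R]) (p y)%:E)%E /\
  (P t `[c, +oo[%classic = \int[lebesgue_measure]_(y in `[(c - t)%R, +oo[) (p y)%:E)%E.
Proof.
move=> [mp p0 _] Pp Tt.
have mpD (D : set R) : measurable_fun D (EFin \o p).
  exact/measurable_funTS/measurable_EFinP.
split; rewrite Pp//.
- rewrite -(ge0_integral_translation t (EFin \o p))//.
  by congr integral; apply/seteqP; split => x /=; rewrite !in_itv/= lerD2r.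
- rewrite -(ge0_integral_translation t (EFin \o p))//.
  by congr integral; apply/seteqP; split => x /=; rewrite !in_itv/= !andbT lerD2r.
Qed.

(** A quantitative form of the identifiability of a location model. Moving the
    location to the right by [delta] or more lowers the mass of the half-line
    ]-oo, t0] to at most that of ]-oo, - delta] under the density [p], and this
    is a strict loss because [p] is positive; moving to the left does the same
    to [t0, +oo[. *)
Lemma location_separation {R : realType} (p : R -> R) (Theta : set R)
    (P : R -> probability (measurableTypeR R) R) (t0 delta : R) :
  is_density p -> (forall x, 0 < p x) -> is_location_model p Theta P ->
  Theta t0 -> 0 < delta ->
  exists A B : set (measurableTypeR R), exists a b : R,
    [/\ measurable A, measurable B, (a%:E < P t0 A)%E, (b%:E < P t0 B)%E &
      forall t, Theta t -> delta <= `|t - t0| ->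
        (P t A <= a%:E)%E \/ (P t B <= b%:E)%E].
Proof.
move=> pd p0 Pp T0 d0; have [mp _ p1] := pd.
have ip : lebesgue_measure.-integrable [set: R] (EFin \o p).
  apply/integrableP; split; first exact/measurable_EFinP.
  under eq_integral => x _ do rewrite /= gtr0_norm//.
  by rewrite p1 ltry.
have fin (D : set (measurableTypeR R)) : measurable D ->
    (\int[lebesgue_measure]_(y in D) (p y)%:E)%E \is a fin_num.
  by move=> mD; apply: integrable_fin_num => //; exact: integrableS ip.
exists `]-oo, t0]%classic, `[t0, +oo[%classic.
exists (fine (\int[lebesgue_measure]_(y in `]-oo, (- delta)%R]) (p y)%:E)%E).
exists (fine (\int[lebesgue_measure]_(y in `[delta, +oo[) (p y)%:E)%E).
have [-> ->] := location_halfline p Theta P t0 t0 pd Pp T0.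
rewrite subrr !fineK ?fin//.
have mono (D E : set (measurableTypeR R)) : measurable D -> measurable E ->
    D `<=` E -> (\int[lebesgue_measure]_(y in D) (p y)%:E <=
      \int[lebesgue_measure]_(y in E) (p y)%:E)%E.
  move=> mD mE DE; apply: ge0_subset_integral => //.
  - exact/measurable_funTS/measurable_EFinP.
  - by move=> x _; rewrite lee_fin ltW.
split => //.
- apply: lt_integral_subset => //.
    by move=> x /=; rewrite !in_itv/= => /le_trans; apply; lra.
  rewrite (_ : _ `\` _ = `](- delta), 0]%classic); last first.
    apply/seteqP; split => x /=; rewrite !in_itv/=.
      by move=> [-> /negP]; rewrite -ltNge => ->.
    by move=> /andP[? ->]; split=> //; apply/negP; rewrite -ltNge.
  rewrite [ltRHS]lebesgue_measure_itv /= lte_fin oppr_lt0 d0 -EFinB lte_fin; lra.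
- apply: lt_integral_subset => //.
    by move=> x /=; rewrite !in_itv/= !andbT; apply: le_trans; exact: ltW.
  rewrite (_ : _ `\` _ = `[0, delta[%classic); last first.
    apply/seteqP; split => x /=; rewrite !in_itv/= !andbT.
      by move=> [-> /negP]; rewrite -ltNge => ->.
    by move=> /andP[-> ?]; split=> //; apply/negP; rewrite -ltNge.
  rewrite [ltRHS]lebesgue_measure_itv /= lte_fin d0 -EFinB lte_fin; lra.
- move=> t Tt; rewrite ler_normr => dt.
  have [-> ->] := location_halfline p Theta P t t0 pd Pp Tt.
  case/orP: dt => dt; [left|right]; apply: mono => // x /=; rewrite !in_itv/= ?andbT; lra.
Qed.

(** * The dual criterion has a well-separated maximum *)

(** The sublevel sets [w < 1 / n] decrease to the empty set. *)
Lemma small_sublevel {d : measure_display} {T : measurableType d}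
    {R : realType} (Q : probability T R) (w : T -> R) (eps : R) :
  measurable_fun [set: T] w -> (forall x, 0 < w x) -> 0 < eps ->
  exists2 c : R, 0 < c & (Q [set x | (w x < c)%R] <= eps%:E)%E.
Proof.
move=> mw w0 e0.
pose F (n : nat) := [set x | w x < n.+1%:R^-1].
have mF n : measurable (F n).
  rewrite -[F n]setTI; have -> : F n = w @^-1` `]-oo, n.+1%:R^-1[.
    by apply/seteqP; split => x; rewrite /F /= in_itv.
  exact: mw.
have F0 : \bigcap_n F n = set0.
  apply/seteqP; split => // x Fx.
  have := Fx (Num.truncn (w x)^-1) I; rewrite /F /=.
  rewrite -[ltLHS]invrK ltf_pV2 ?posrE ?invr_gt0// ltNge => /negP; apply.
  by apply/ltW/truncnS_gt.
have cF : Q \o F @ \oo --> 0%E.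
  rewrite -(measure0 Q) -F0; apply: nonincreasing_cvg_mu => //.
  - by rewrite ltey_eq fin_num_measure.
  - by rewrite F0.
  - apply/nonincreasing_seqP => n; apply/subsetPset => x; rewrite /F /= => /lt_trans.
    by apply; rewrite ltf_pV2 ?posrE// ltr_nat.
have [n _ Fn] : \forall n \near \oo, (Q (F n) < eps%:E)%E.
  apply: (cF [set y | (y < eps%:E)%E]); apply: open_nbhs_nbhs.
  by split; [exact: open_ereal_lt_ereal|rewrite /= lte_fin].
exists n.+1%:R^-1; first by rewrite invr_gt0.
exact/ltW/(Fn n)/leqnn.
Qed.

(** Here [Q] is the law of density p_theta0 and [t] stands for p_theta0 / p_theta,
    so that the integral of [1 / t] over [A] is the probability of [A] under
    theta. If it falls short of [Q A], then [t] exceeds some [u > 1] on a part of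
    [A] of substantial mass, on most of which the weight [w] is at least some
    [c > 0]. The loss [kappa] depends on [A] and [a] but not on [t]. *)
Lemma integral_dlog_gap_lbound {d : measure_display} {T : measurableType d}
    {R : realType} (Q : probability T R) (w : T -> R) (g a : R) (A : set T) :
  measurable A -> measurable_fun [set: T] w -> (forall x, 0 < w x) ->
  (a%:E < Q A)%E ->
  exists2 kappa : R, 0 < kappa & forall t : T -> R,
    measurable_fun [set: T] t -> (forall x, 0 < t x) ->
    (\int[Q]_(x in A) (t x)^-1%:E <= a%:E)%E ->
    (kappa%:E <= \int[Q]_x (w x * dlog_gap g (t x))%:E)%E.
Proof.
move=> mA mw w0 aQA.
pose q := fine (Q A).
have QA : Q A = q%:E by rewrite /q fineK// fin_num_measure.
have q1 : q <= 1 by rewrite -lee_fin -QA probability_le1.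
have aq : a < q by rewrite -lte_fin -QA.
(* As [q <= 1], this [u] is close enough to 1 to keep [u * a < q]. *)
pose u := 1 + (q - a) / 2.
have u1 : 1 < u by rewrite /u; lra.
pose eps := q - u * a.
have eps0 : 0 < eps by rewrite /eps /u; nra.
have e20 : 0 < eps / 2 by rewrite divr_gt0.
have [c c0 Qc] := small_sublevel Q w (eps / 2) mw w0 e20.
have gu0 : 0 < dlog_gap g u by rewrite -(dlog_gap1 g); exact: dlog_gap_lt.
pose k := c * dlog_gap g u.
have k0 : 0 < k by rewrite mulr_gt0.
exists (k * (eps / 2)); first by rewrite mulr_gt0.
move=> t mt t0 ta.
pose W := [set x | w x < c].
have mW : measurable W.
  rewrite -[W]setTI; have -> : W = w @^-1` `]-oo, c[.
    by apply/seteqP; split => x; rewrite /W /= in_itv.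
  exact: mw.
have mV : measurable_fun [set: T] (fun x => (t x)^-1).
  have -> : (fun x => (t x)^-1) = (fun x => 1 / t x).
    by apply/funext => x; rewrite mul1r.
  exact: measurable_div.
have mG : measurable_fun [set: T] (fun x => w x * dlog_gap g (t x)).
  apply: measurable_funM => //; apply: measurable_funB.
    exact: measurableT_comp (measurable_dlog _) mt.
  exact: measurableT_comp (measurable_dlog _) mt.
have G0 x : 0 <= w x * dlog_gap g (t x).
  by rewrite mulr_ge0 ?dlog_gap_ge0// ltW.
have I0 : (0 <= \int[Q]_x (w x * dlog_gap g (t x))%:E)%E.
  by apply: integral_ge0 => x _; rewrite lee_fin.
have u0 : 0 <= u by lra.
have t1_ge0 x : 0 <= (t x)^-1 * \1_A x by rewrite mulr_ge0// invr_ge0 ltW.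
(* A point of [A] satisfies [t <= u], or [w < c], or has both [t > u] and
   [w >= c]; each case is paid for by one summand. *)
have pw x : \1_A x <= u * ((t x)^-1 * \1_A x) + \1_W x +
    k^-1 * (w x * dlog_gap g (t x)) :> R.
  have kG : 0 <= k^-1 * (w x * dlog_gap g (t x)) by rewrite mulr_ge0// invr_ge0 ltW.
  have W1 : 0 <= \1_W x :> R by [].
  have uA : 0 <= u * ((t x)^-1 * \1_A x) by rewrite mulr_ge0.
  have [Ax|nAx] := pselect (A x); last first.
    by rewrite [leLHS]indicE memNset//= !addr_ge0.
  rewrite [leLHS]indicE mem_set//=.
  have [tu|ut] := leP (t x) u.
    suff : 1 <= u * ((t x)^-1 * \1_A x) by lra.
    by rewrite indicE mem_set// mulr1 ler_pdivlMr// mul1r.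
  have [wc|cw] := ltP (w x) c.
    suff : \1_W x = 1 :> R by lra.
    by rewrite indicE mem_set.
  suff : 1 <= k^-1 * (w x * dlog_gap g (t x)) by lra.
  rewrite mulrC ler_pdivlMr// mul1r /k ler_pM// ?ltW//.
  by apply: dlog_gap_lt => //; exact: ltW.
have key : (Q A <= u%:E * \int[Q]_(x in A) (t x)^-1%:E + Q W +
    (k^-1)%:E * \int[Q]_x (w x * dlog_gap g (t x))%:E)%E.
  rewrite -[X in (X <= _)%E](congr1 Q (setIT A)) -integral_indic// (integral_mkcond A).
  rewrite -[Q W](congr1 Q (setIT W)) -integral_indic// epatch_indic.
  have mtA : measurable_fun [set: T] (fun x => (t x)^-1 * \1_A x) by exact: measurable_funM.
  rewrite -ge0_integralZl//; last 2 first.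
  - exact/measurable_EFinP.
  - by move=> x _; rewrite -EFinM lee_fin.
  rewrite -ge0_integralZl//; last 3 first.
  - exact/measurable_EFinP.
  - by move=> x _; rewrite lee_fin.
  - by rewrite lee_fin invr_ge0 ltW.
  have mutA : measurable_fun [set: T] (fun x => u%:E * ((t x)^-1 * \1_A x)%:E)%E.
    by apply/measurable_EFinP; exact: measurable_funM.
  rewrite -ge0_integralD//; last 2 first.
  - by move=> x _; rewrite -!EFinM lee_fin mulr_ge0.
  - by apply/measurable_EFinP; exact: measurable_indic.
  rewrite -ge0_integralD//; last 4 first.
  - by move=> x _; rewrite -!EFinM -EFinD lee_fin addr_ge0// mulr_ge0.
  - by apply: emeasurable_funD => //; apply/measurable_EFinP; exact: measurable_indic.
  - by move=> x _; rewrite -EFinM lee_fin mulr_ge0// invr_ge0 ltW.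
  - by apply/measurable_EFinP; exact: measurable_funM.
  apply: ge0_le_integral => //.
  - by apply/measurable_EFinP; exact: measurable_indic.
  - apply: emeasurable_funD.
      by apply: emeasurable_funD => //; apply/measurable_EFinP; exact: measurable_indic.
    by apply/measurable_EFinP; exact: measurable_funM.
  - by move=> x _; rewrite -!EFinM -!EFinD lee_fin.
case: (\int[Q]_x (w x * dlog_gap g (t x))%:E)%E I0 key =>
  [I _|_ _|//]; last by rewrite leey.
have : (\int[Q]_(x in A) (t x)^-1%:E \is a fin_num)%E.
  rewrite ge0_fin_numE; first exact: le_lt_trans ta (ltry _).
  by apply: integral_ge0 => x _; rewrite lee_fin invr_ge0 ltW.
have : Q W \is a fin_num by rewrite fin_num_measure.
move: ta Qc; rewrite -/W.
case: (Q W) => // v; case: (\int[Q]_(x in A) (t x)^-1%:E)%E => // s.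
rewrite QA => sa vc _ _; rewrite -!EFinM -!EFinD => key.
rewrite !lee_fin in sa vc key *.
rewrite mulrC -ler_pdivlMr// mulrC.
have : u * s <= u * a by rewrite ler_wpM2l.
rewrite /eps in vc *; lra.
Qed.

Lemma integrable_EFinB {d : measure_display} {T : measurableType d}
    {R : realType} (mu : {measure set T -> \bar R}) (f g : T -> R) :
  mu.-integrable [set: T] (EFin \o f) -> mu.-integrable [set: T] (EFin \o g) ->
  mu.-integrable [set: T] (EFin \o (fun x => f x - g x)).
Proof. by move=> intf intg; exact: (integrableB _ intf intg). Qed.

Lemma density_ratio_gt0 {R : realType} (p : R -> R) (alpha theta x : R) :
  (forall x, 0 < p x) -> 0 < density_ratio p alpha theta x.
Proof. by move=> p0; rewrite divr_gt0. Qed.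

Lemma measurable_density_ratio {R : realType} (p : R -> R) (alpha theta : R) :
  measurable_fun [set: R] p -> (forall x, 0 < p x) ->
  measurable_fun [set: R] (density_ratio p alpha theta).
Proof.
move=> mp p0.
have mt (h : R) : measurable_fun [set: R] (fun x => p (x - h)).
  by apply: (measurableT_comp mp); exact: measurable_funB.
exact: measurable_div.
Qed.

(** This reduces the dependence of the criterion on [x] to [dlog], uniformly in
    the index, at the price of a term independent of [x]. *)
Lemma m_funE {R : realType} (g : R) (p : R -> R)
    (P : R -> probability (measurableTypeR R) R) (theta alpha x : R) :
  (forall x, 0 < p x) ->
  m_fun (cressie_read g) p P theta alpha x =
  \int[P alpha]_y (derive1 (cressie_read g) (density_ratio p alpha theta y)) -
  dlog g (density_ratio p alpha theta x).
Proof.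
by move=> p0; rewrite /m_fun cressie_read_conjugate// density_ratio_gt0.
Qed.

Lemma measurable_m_fun {R : realType} (g : R) (p : R -> R)
    (P : R -> probability (measurableTypeR R) R) (theta alpha : R) :
  measurable_fun [set: R] p -> (forall x, 0 < p x) ->
  measurable_fun [set: R] (m_fun (cressie_read g) p P theta alpha).
Proof.
move=> mp p0.
rewrite (_ : m_fun _ _ _ _ _ = fun x =>
  \int[P alpha]_y (derive1 (cressie_read g) (density_ratio p alpha theta y)) -
  dlog g (density_ratio p alpha theta x)).
  apply: measurable_funB => //.
  exact: measurableT_comp (measurable_dlog _) (measurable_density_ratio _ _ _ mp p0).
by apply/funext => x; exact: m_funE.
Qed.

(** The difference of the criteria is a Bregman divergence. The term
    [C t0 - C t], an integral under P_alpha, becomes an integral under P_t0 of an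
    integrand carrying the factor p_alpha / p_t0; [dlogM] then takes the power
    [g] of p_alpha / p_t0 out of both terms. *)
Lemma dual_criterion_gap {R : realType} (g : R) (p : R -> R)
    (P : R -> probability (measurableTypeR R) R) (Theta : set R)
    (alpha t0 t : R)
    (m := fun th => m_fun (cressie_read g) p P th alpha) :
  is_density p -> (forall x, 0 < p x) -> is_location_model p Theta P ->
  Theta alpha -> Theta t0 ->
  (forall th, th = t0 \/ th = t -> (P alpha).-integrable [set: R]
     (EFin \o (fun y : measurableTypeR R =>
       derive1 (cressie_read g) (density_ratio p alpha th y)))) ->
  (forall th, th = t0 \/ th = t -> (P t0).-integrable [set: R]
     (EFin \o (m th : measurableTypeR R -> R))) ->
  (\int[P t0]_x (density_ratio p alpha t0 x `^ g *
     dlog_gap g (density_ratio p t0 t x))%:E =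
   (\int[P t0]_x m t0 x - \int[P t0]_x m t x)%:E)%E.
Proof.
move=> [mp p0' p1] p0 Pp Ta T0 IC Im.
have [IC0 ICt] := (IC t0 (or_introl erefl), IC t (or_intror erefl)).
have [Im0 Imt] := (Im t0 (or_introl erefl), Im t (or_intror erefl)).
pose s := density_ratio p alpha t0; pose r := density_ratio p alpha t.
pose u := density_ratio p t0 t.
have s0 x : 0 < s x by exact: density_ratio_gt0.
have r0 x : 0 < r x by exact: density_ratio_gt0.
have u0 x : 0 < u x by exact: density_ratio_gt0.
have ru x : r x = s x * u x.
  by rewrite /r /s /u /density_ratio mulrA divfK// gt_eqF.
pose C th := \int[P alpha]_y
  (derive1 (cressie_read g) (density_ratio p alpha th y)).
pose k := fun y : measurableTypeR R =>
  derive1 (cressie_read g) (r y) - derive1 (cressie_read g) (s y).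
have Ik : (P alpha).-integrable [set: R] (EFin \o k).
  exact: integrable_EFinB.
have kE x : k x = s x `^ (g - 1) * dlog (g - 1) (u x).
  by rewrite /k !derive1_cressie_read// ru dlogM// addrC addKr.
have mt (h : R) : measurable_fun [set: R] (fun x => p (x - h)).
  by apply: (measurableT_comp mp); exact: measurable_funB.
have [Iks intks] := @integral_density_ratio _ _ R lebesgue_measure (P alpha) (P t0)
  (fun x => p (x - alpha)) (fun x => p (x - t0)) k (mt alpha) (mt t0)
  (fun x => p0' _) (fun x => p0 _) (Pp _ Ta) (Pp _ T0) Ik.
have ksE x : k x * (p (x - alpha) / p (x - t0)) = s x `^ g * dlog (g - 1) (u x).
  by rewrite -/(density_ratio p alpha t0 x) -/(s x) kE -(powRS g (s x)); first ring.
pose j := fun x : measurableTypeR R => m t0 x - m t x.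
have Ij : (P t0).-integrable [set: R] (EFin \o j).
  exact: integrable_EFinB.
have wE x : s x `^ g * dlog_gap g (u x) =
    j x - (C t0 - C t) - k x * (p (x - alpha) / p (x - t0)).
  rewrite ksE /dlog_gap mulrBr; congr (_ - _).
  rewrite /j /m !m_funE// -/(r x) -/(s x) ru dlogM// -/(C t0) -/(C t).
  by move: (C t0) (C t) (dlog g (s x)) (_ `^ _ * _) => a b c d; ring.
have Ic (c : R) : (P t0).-integrable [set: R] (EFin \o cst c).
  exact: finite_measure_integrable_cst.
have Ijc : (P t0).-integrable [set: R] (EFin \o (fun x => j x - (C t0 - C t))).
  exact: (integrable_EFinB _ j (cst (C t0 - C t))).
transitivity (\int[P t0]_x (s x `^ g * dlog_gap g (u x)))%:E.
  rewrite /Rintegral fineK//; apply: integrable_fin_num => //.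
  under eq_fun do rewrite wE.
  exact: integrable_EFinB.
congr EFin; under eq_Rintegral do rewrite wE.
rewrite (RintegralB _ Ijc Iks)// (RintegralB _ Ij (Ic (C t0 - C t)))//.
rewrite (RintegralB _ Im0 Imt)//.
rewrite Rintegral_cst//= [X in fine X]probability_setT mulr1.
rewrite [X in _ - X](_ : _ = C t - C t0).
  have cancel a b c : a - (b - c) - (c - b) = a :> R by ring.
  exact: cancel.
transitivity (\int[P alpha]_x k x).
  by rewrite /Rintegral intks.
by rewrite RintegralB.
Qed.

(** The event that separates [t] from [t0] is one of two fixed half-lines, so
    two applications of [integral_dlog_gap_lbound] bound the loss uniformly. *)
Lemma dual_criterion_separated {R : realType} (g : R) (p : R -> R)
    (P : R -> probability (measurableTypeR R) R) (Theta : set R)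
    (alpha t0 delta : R)
    (m := fun th => m_fun (cressie_read g) p P th alpha) :
  is_density p -> (forall x, 0 < p x) -> is_location_model p Theta P ->
  Theta alpha -> Theta t0 ->
  (forall th, Theta th -> (P alpha).-integrable [set: R]
     (EFin \o (fun y : measurableTypeR R =>
       derive1 (cressie_read g) (density_ratio p alpha th y)))) ->
  (P t0).-integrable [set: R] (EFin \o (m t0 : measurableTypeR R -> R)) ->
  0 < delta ->
  exists2 kappa : R, 0 < kappa & forall t, Theta t ->
    (P t0).-integrable [set: R] (EFin \o (m t : measurableTypeR R -> R)) ->
    delta <= `|t - t0| ->
    \int[P t0]_x m t x <= \int[P t0]_x m t0 x - kappa.
Proof.
move=> pd p0 Pp Ta T0 IC Im0 d0; have [mp p0' _] := pd.
have [A [B [a [b [mA mB aA bB sep]]]]] :=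
  location_separation p Theta P t0 delta pd p0 Pp T0 d0.
pose w := fun x : measurableTypeR R => density_ratio p alpha t0 x `^ g.
have w0 x : 0 < w x by rewrite powR_gt0// density_ratio_gt0.
have mw : measurable_fun [set: measurableTypeR R] w.
  by apply: (measurableT_comp (measurable_powR g)); exact: measurable_density_ratio.
have [ka ka0 hA] := @integral_dlog_gap_lbound _ _ _ (P t0) w g a A mA mw w0 aA.
have [kb kb0 hB] := @integral_dlog_gap_lbound _ _ _ (P t0) w g b B mB mw w0 bB.
exists (Num.min ka kb); first by rewrite lt_min ka0.
move=> t Tt Imt dt.
have gapE := dual_criterion_gap g p P Theta alpha t0 t pd p0 Pp Ta T0 _ _.
rewrite lerBrDl -lerBrDr -lee_fin -gapE; last 2 first.
- by move=> th [->|->]; exact: IC.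
- by move=> th [->|->].
have mt (h : R) : measurable_fun [set: R] (fun x => p (x - h)).
  by apply: (measurableT_comp mp); exact: measurable_funB.
have PtE (D : set (measurableTypeR R)) : measurable D ->
    (\int[P t0]_(x in D) (density_ratio p t0 t x)^-1%:E = P t D)%E.
  move=> mD.
  have ID : (P t).-integrable [set: measurableTypeR R] (EFin \o \1_D).
    exact: integrable_indic.
  have [_] := @integral_density_ratio _ _ R lebesgue_measure (P t) (P t0)
    (fun x => p (x - t)) (fun x => p (x - t0)) \1_D (mt t) (mt t0)
    (fun x => p0' _) (fun x => p0 _) (Pp _ Tt) (Pp _ T0) ID.
  rewrite integral_indic// setIT => <-.
  rewrite integral_mkcond epatch_indic; apply: eq_integral => x _.
  by rewrite /= /density_ratio invf_div muleC.
have mu := measurable_density_ratio p t0 t mp p0.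
have u0 x : 0 < density_ratio p t0 t x by exact: density_ratio_gt0.
have [PA|PB] := sep t Tt dt.
- apply: le_trans (hA _ mu u0 _); first by rewrite lee_fin ge_min lexx.
  by rewrite PtE.
- apply: le_trans (hB _ mu u0 _); first by rewrite lee_fin ge_min lexx orbT.
  by rewrite PtE.
Qed.

(** * Contaminated measures *)

Lemma ge0_integral_contamination {R : realType}
    (Q : {measure set (measurableTypeR R) -> \bar R}) (x e : R)
    (f : measurableTypeR R -> \bar R) :
  0 <= e <= 1 -> measurable_fun [set: measurableTypeR R] f ->
  (forall y, 0 <= f y)%E ->
  (\int[contamination Q x e]_y f y =
   (1 - e)%:E * \int[Q]_y f y + e%:E * f x)%E.
Proof.
move=> /andP[e0 e1] mf f0; rewrite ge0_integral_measure_add//.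
rewrite !ge0_integral_mscale// integral_dirac// diracT mul1e /=.
by rewrite !ger0_norm// subr_ge0.
Qed.

Lemma integral_contamination {R : realType}
    (Q : {measure set (measurableTypeR R) -> \bar R}) (x e : R)
    (f : measurableTypeR R -> R) :
  0 <= e <= 1 -> Q.-integrable [set: R] (EFin \o f) ->
  (\int[contamination Q x e]_y (f y)%:E =
   ((1 - e) * \int[Q]_y f y + e * f x)%:E)%E.
Proof.
move=> e01 If.
have mf := measurable_int _ If.
have fp : (\int[Q]_y (EFin \o f)^\+ y)%E \is a fin_num.
  exact: integrable_pos_fin_num.
have fn : (\int[Q]_y (EFin \o f)^\- y)%E \is a fin_num.
  exact: integrable_neg_fin_num.
rewrite /Rintegral [in RHS]integralE [LHS]integralE.
rewrite !ge0_integral_contamination//; last 2 first.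
- exact: measurable_funeneg.
- exact: measurable_funepos.
rewrite -(fineK fp) -(fineK fn) funeposE funenegE /= -!EFin_max.
rewrite -!EFinM -!EFinD /=; congr EFin.
have fE : f x = Num.max (f x) 0 - Num.max (- f x) 0.
  case/orP: (le_total 0 (f x)) => f0.
    by rewrite (max_l f0) max_r ?oppr_le0// subr0.
  by rewrite (max_r f0) max_l ?oppr_ge0// sub0r opprK.
rewrite [in RHS]fE; ring.
Qed.

(** A criterion that is infinite at [Q] because of the negative part stays so
    under contamination; the integral is -oo even if the positive part diverges
    as well, by the convention that -oo absorbs +oo. *)
Lemma integral_contamination_Ny {R : realType}
    (Q : {measure set (measurableTypeR R) -> \bar R}) (x e : R)
    (f : measurableTypeR R -> R) :
  0 <= e < 1 -> measurable_fun [set: R] f ->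
  (\int[Q]_y (EFin \o f)^\- y = +oo)%E ->
  (\int[contamination Q x e]_y (f y)%:E = -oo)%E.
Proof.
move=> /andP[e0 e1] mf fy; rewrite integralE.
have e01 : 0 <= e <= 1 by rewrite e0 ltW.
rewrite [X in (_ - X)%E]ge0_integral_contamination//; last first.
  exact/measurable_funeneg/measurable_EFinP.
rewrite fy gt0_muley ?lte_fin ?subr_gt0//.
by rewrite addye ?addeNy// funenegE /= -EFin_max -EFinM.
Qed.

(** * Perturbed maximization problems *)

(** [M] is to be thought of as the criterion at the model and [k] as the
    criterion at the point mass. A single maximizer at level [e1] bounds
    [(1 - e1) * M + e1 * k] from above, hence bounds [k] by an affine function of
    [- M]. Inserting this in the optimality of [tau e] at a smaller level [e]
    shows that [M t0 - M (tau e)] is at most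
    [e * K / (e1 - e)], which tends to 0. *)
Lemma perturbed_argmax_cvg {R : realType} (I : set R) (M k tau : R -> R)
    (t0 : R) : I t0 ->
  (forall delta, 0 < delta -> exists2 kappa : R, 0 < kappa &
     forall t, I t -> delta <= `|t - t0| -> M t <= M t0 - kappa) ->
  (\forall e \near 0^'+, I (tau e) /\ forall t, I t ->
     (1 - e) * M t + e * k t <= (1 - e) * M (tau e) + e * k (tau e)) ->
  tau e @[e --> 0^'+] --> t0.
Proof.
move=> I0 sep max.
have Mle t : I t -> M t <= M t0.
  move=> It; have [->//|tt0] := eqVneq t t0.
  have d0 : 0 < `|t - t0| by rewrite normr_gt0 subr_eq0.
  have [kappa k0 /(_ t It (lexx _))] := sep _ d0; lra.
have [e1 [e10 e11 [I1 max1]]] : exists e1, [/\ 0 < e1, e1 < 1 & I (tau e1) /\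
    forall t, I t ->
      (1 - e1) * M t + e1 * k t <= (1 - e1) * M (tau e1) + e1 * k (tau e1)].
  have : \forall e \near 0^'+, [/\ 0 < e, e < 1 & I (tau e) /\ forall t, I t ->
     (1 - e) * M t + e * k t <= (1 - e) * M (tau e) + e * k (tau e)].
    near=> e; split.
    - by near: e; exact: nbhs_right_gt.
    - by near: e; exact: nbhs_right_lt.
    - by near: e; exact: max.
  by move/filter_ex => [e he]; exists e.
(* The amount by which the optimal value at level [e1] exceeds the value at
   [t0]. *)
pose K := (1 - e1) * (M (tau e1) - M t0) + e1 * (k (tau e1) - k t0).
have K0 : 0 <= K by have := max1 _ I0; rewrite /K; lra.
apply/cvgrPdist_lt => delta delta0.
have [kappa kappa0 far] := sep _ delta0.
near=> e.
have e0 : 0 < e by near: e; exact: nbhs_right_gt.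
have ee1 : e < e1 by near: e; exact: nbhs_right_lt.
have [Ie maxe] : I (tau e) /\ forall t, I t ->
    (1 - e) * M t + e * k t <= (1 - e) * M (tau e) + e * k (tau e).
  by near: e; exact: max.
have eK : e * (K + kappa) < e1 * kappa.
  rewrite -ltr_pdivlMr; last by lra.
  by near: e; apply: nbhs_right_lt; rewrite divr_gt0 ?mulr_gt0//; lra.
rewrite distrC ltNge; apply/negP => /(far _ Ie) fe.
have h1 := max1 _ Ie; have h0 := maxe _ I0; have hM := Mle _ Ie.
set d := M t0 - M (tau e); have dk : kappa <= d by rewrite /d; lra.
have h2 : (e1 - e) * d <= e * K.
  have : e1 * ((1 - e) * d) <= e1 * (e * (k (tau e) - k t0)).
    by rewrite ler_pM2l// /d; lra.
  have : e * (e1 * (k (tau e) - k t0)) <= e * ((1 - e1) * d + K).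
    by rewrite ler_pM2l// /d /K; lra.
  rewrite /d; nra.
have : (e1 - e) * kappa <= (e1 - e) * d by rewrite ler_pM2l//; lra.
lra.
Unshelve. all: by end_near. Qed.

(** The equation is solved for the increment of [tau] by writing [G t] as
    [q t * (t - t0)] with [q] continuous at [t0]; this avoids dividing by
    [tau e - t0], which may vanish. *)
Lemma cvg_implicit_slope {R : realType} (G k tau : R -> R) (t0 : R) :
  derivable G t0 1 -> G t0 = 0 -> derive1 G t0 != 0 ->
  {for t0, continuous k} -> tau e @[e --> 0^'+] --> t0 ->
  (\forall e \near 0^'+, (1 - e) * G (tau e) + e * k (tau e) = 0) ->
  (tau e - t0) / e @[e --> 0^'+] --> - k t0 / derive1 G t0.
Proof.
move=> dG G0 G'0 ck taut0 foc.
pose q t := if t == t0 then derive1 G t0 else G t / (t - t0).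
have qE t : G t = q t * (t - t0).
  rewrite /q; case: eqVneq => [->|tt0]; first by rewrite G0 subrr mulr0.
  by rewrite divfK// subr_eq0.
have cq : {for t0, continuous q}.
  apply/continuous_withinNshiftx; rewrite {2}/q eqxx.
  have slope : h^-1 *: (G (h + t0) - G t0) @[h --> 0^'] --> derive1 G t0.
    by move: dG; rewrite /derivable /derive1; under eq_fun do rewrite scaler1.
  apply: cvg_trans slope; apply: near_eq_cvg; near=> h.
  have h0 : h != 0 by near: h; exact: nbhs_dnbhs_neq.
  rewrite /= /q G0 subr0 addrK -subr_eq0 addrK (negbTE h0).
  by rewrite /GRing.scale /= mulrC.
have qtau : q (tau e) @[e --> 0^'+] --> derive1 G t0.
  have -> : derive1 G t0 = q t0 by rewrite /q eqxx.
  exact: cvg_comp taut0 cq.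
have ktau : k (tau e) @[e --> 0^'+] --> k t0 by exact: cvg_comp taut0 ck.
have e1 : (1 - e : R) @[e --> 0^'+] --> (1 : R).
  rewrite -[X in _ --> X]subr0; apply: cvgB; first exact: cvg_cst.
  exact: cvg_at_right_filter.
have q0 : \forall e \near 0^'+, q (tau e) != 0.
  exact: (cvgr_neq0 _ qtau).
have lim1 : - k (tau e) / ((1 - e) * q (tau e)) @[e --> 0^'+] -->
    - k t0 / (1 * derive1 G t0).
  apply: cvgM; first exact: cvgN.
  by apply: cvgV; [rewrite mul1r|exact: cvgM].
rewrite mul1r in lim1; apply: cvg_trans lim1; apply: near_eq_cvg.
near=> e.
have e0 : 0 < e by near: e; exact: nbhs_right_gt.
have e11 : e < 1 by near: e; exact: nbhs_right_lt.
have qe : q (tau e) != 0 by near: e.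
have : (1 - e) * G (tau e) + e * k (tau e) = 0 by near: e.
rewrite qE => h.
have -> : - k (tau e) = (1 - e) * q (tau e) * ((tau e - t0) / e).
  apply: (mulIf (lt0r_neq0 e0)); rewrite -!mulrA mulVf ?gt_eqF// mulr1; lra.
by rewrite mulrAC divff ?mul1r// mulf_neq0// subr_eq0 gt_eqF.
Unshelve. all: by end_near. Qed.

(** * Influence function of an M-estimator *)

(** The derivative is a limit of difference quotients along a sequence. *)
Lemma measurable_derive1_param {d : measure_display} {T : measurableType d}
    {R : realType} (m : R -> T -> R) (t : R) :
  (forall s, measurable_fun [set: T] (m s)) ->
  (forall x, derivable (m ^~ x) t 1) ->
  measurable_fun [set: T] (fun x => derive1 (m ^~ x) t).
Proof.
move=> mm dm.
have slope x : e^-1 *: (m (e + t) x - m t x) @[e --> 0^'] --> derive1 (m ^~ x) t.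
  by have := dm x; rewrite /derivable /derive1; under eq_fun do rewrite scaler1.
apply: (@measurable_fun_cvg _ _ _ _ (fun (n : nat) x =>
    (n.+1%:R^-1)^-1 *: (m (n.+1%:R^-1 + t) x - m t x))).
  by move=> n; apply: measurable_funM => //; exact: measurable_funB.
move=> x _; move: (slope x) => /cvgr_dnbhsP; apply; split.
  by move=> n; rewrite invr_eq0 pnatr_eq0.
exact: cvg_harmonic.
Qed.

(** Two functions at an integrable distance have their positive parts, and also
    their negative parts, integrable simultaneously. One integral being less
    than +oo and the other more than -oo therefore leaves no room for an
    infinite part. *)
Lemma nearby_integrable {d : measure_display} {T : measurableType d}
    {R : realType} (Q : {measure set T -> \bar R}) (f g h : T -> R) :
  measurable_fun [set: T] f -> measurable_fun [set: T] g ->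
  Q.-integrable [set: T] (EFin \o h) -> (forall x, `|f x - g x| <= h x) ->
  (\int[Q]_x (f x)%:E < +oo)%E -> (-oo < \int[Q]_x (g x)%:E)%E ->
  Q.-integrable [set: T] (EFin \o g).
Proof.
move=> mf mg Ih fgh fy gNy.
have h0 x : 0 <= h x by exact: le_trans (fgh x).
have mh := measurable_int _ Ih.
have hy : (\int[Q]_x (h x)%:E < +oo)%E by exact: integrable_lty.
have mp (k : T -> R) : measurable_fun [set: T] k ->
    measurable_fun [set: T] (EFin \o k)^\+%E.
  by move=> mk; apply: measurable_funepos; exact/measurable_EFinP.
have mn (k : T -> R) : measurable_fun [set: T] k ->
    measurable_fun [set: T] (EFin \o k)^\-%E.
  by move=> mk; apply: measurable_funeneg; exact/measurable_EFinP.
have gn : (\int[Q]_x (EFin \o g)^\- x < +oo)%E.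
  rewrite ltNge leye_eq; apply/negP => /eqP gn.
  by move: gNy; rewrite integralE gn addeNy ltxx.
have fn : (\int[Q]_x (EFin \o f)^\- x < +oo)%E.
  apply: (@le_lt_trans _ _ (\int[Q]_x ((EFin \o g)^\- x + (h x)%:E))%E).
    apply: ge0_le_integral => //; [exact: mn|apply: emeasurable_funD => //; exact: mn|].
    move=> x _; rewrite !funenegE /= -!EFin_max -EFinD lee_fin.
    have := fgh x; rewrite ler_norml => /andP[h1 h2].
    rewrite ge_max; apply/andP; split; last by rewrite addr_ge0// le_max lexx orbT.
    by apply: (@le_trans _ _ (- g x + h x)); [lra|rewrite lerD2r le_max lexx].
  by rewrite ge0_integralD//; [exact: lte_add_pinfty|exact: mn|move=> x _; rewrite lee_fin].
have fp : (\int[Q]_x (EFin \o f)^\+ x < +oo)%E.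
  rewrite ltNge leye_eq; apply/negP => /eqP fp.
  move: fy; rewrite integralE fp; case: (\int[Q]_x (EFin \o f)^\- x)%E fn => //.
have gp : (\int[Q]_x (EFin \o g)^\+ x < +oo)%E.
  apply: (@le_lt_trans _ _ (\int[Q]_x ((EFin \o f)^\+ x + (h x)%:E))%E).
    apply: ge0_le_integral => //; [exact: mp|apply: emeasurable_funD => //; exact: mp|].
    move=> x _; rewrite !funeposE /= -!EFin_max -EFinD lee_fin.
    have := fgh x; rewrite ler_norml => /andP[h1 h2].
    rewrite ge_max; apply/andP; split; last by rewrite addr_ge0// le_max lexx orbT.
    by apply: (@le_trans _ _ (f x + h x)); [lra|rewrite lerD2r le_max lexx].
  by rewrite ge0_integralD//; [exact: lte_add_pinfty|exact: mp|move=> x _; rewrite lee_fin].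
apply/integrableP; split; first exact/measurable_EFinP.
rewrite (_ : (fun x => _) = (EFin \o g)^\+ \+ (EFin \o g)^\-)%E; last first.
  by rewrite -fune_abse.
by rewrite ge0_integralD//; [exact: lte_add_pinfty|exact: mp|exact: mn].
Qed.

Lemma near_itv {R : realType} (t0 : R) (P : R -> Prop) :
  (\forall t \near t0, P t) ->
  exists u v : R, `]u, v[%classic t0 /\ forall t, `]u, v[%classic t -> P t.
Proof.
move=> [r /= r0 rP]; exists (t0 - r), (t0 + r); split.
  by rewrite /= in_itv/=; apply/andP; split; lra.
move=> t; rewrite /= in_itv/= => /andP[t1 t2]; apply: rP.
by rewrite /= ltr_norml; apply/andP; split; lra.
Qed.

Lemma derive1_bound_increment {R : realType} (f : R -> R) (u v c s t : R) :
  (forall x, `]u, v[%classic x -> derivable f x 1) ->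
  (forall x, `]u, v[%classic x -> `|derive1 f x| <= c) ->
  `]u, v[%classic s -> `]u, v[%classic t ->
  `|f s - f t| <= c * `|s - t|.
Proof.
move=> df fc; wlog st : s t / s <= t => [wl us ut|].
  case/orP: (le_total s t) => st; first exact: wl.
  by rewrite distrC (distrC s); exact: wl.
rewrite /= !in_itv/= => /andP[us sv] /andP[ut tv].
have I x : s <= x <= t -> `]u, v[%classic x.
  by move=> /andP[sx xt]; rewrite /= in_itv/= (lt_le_trans us)// (le_lt_trans xt).
have [x||x /I xI fE] := @MVT_segment _ f (derive1 f) s t st.
- rewrite in_itv/= => /andP[sx xt].
  by rewrite derive1E; apply/derivableP/df/I; rewrite !ltW.
- apply: derivable_within_continuous => x; rewrite in_itv/= => /I; exact: df.
- by rewrite distrC fE normrM (distrC s) ler_wpM2r// fc.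
Qed.

Lemma integral_param_derive {d : measure_display} {T : measurableType d}
    {R : realType} (Q : {measure set T -> \bar R}) (m : R -> T -> R)
    (h : T -> R) (u v t : R) :
  `]u, v[%classic t ->
  (forall s, `]u, v[%classic s -> Q.-integrable [set: T] (EFin \o m s)) ->
  (forall s x, `]u, v[%classic s -> derivable (m ^~ x) s 1) ->
  Q.-integrable [set: T] (EFin \o h) ->
  (forall s x, `]u, v[%classic s -> `|derive1 (m ^~ x) s| <= h x) ->
  is_derive t 1 (fun s => \int[Q]_x m s x) (\int[Q]_x derive1 (m ^~ x) t).
Proof.
move=> It Im dm Ih mh.
have h0 x : 0 <= h x by exact: le_trans (mh t x It).
apply: DeriveDef.
  by apply: (@derivable_under_integral _ _ _ Q m _ _ t u v _ _ _ h) => //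
    s y Is _; [exact: dm|exact: mh].
rewrite -derive1E.
by apply: (@differentiation_under_integral _ _ _ Q m _ _ t u v _ _ _ h) => //
    s y Is _; [exact: dm|exact: mh].
Qed.

(** A parameter whose integrand is not integrable has criterion -oo at [Q], as
    the maximum is finite, hence also at the contaminated measure: it
    cannot compete with [t0]. On the remaining ones the contaminated criterion
    is an honest convex combination of real numbers. *)
Lemma contaminated_argmax {R : realType}
    (Q : {measure set (measurableTypeR R) -> \bar R})
    (m : R -> measurableTypeR R -> R) (Theta : set R) (t0 x e t : R)
    (crit := fun (Q' : {measure set (measurableTypeR R) -> \bar R}) s =>
       (\int[Q']_y (m s y)%:E)%E) :
  (forall s, measurable_fun [set: R] (m s)) -> Theta t0 ->
  Q.-integrable [set: R] (EFin \o m t0) ->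
  (forall s, Theta s -> (crit Q s <= crit Q t0)%E) ->
  0 < e < 1 -> argsup Theta (crit (contamination Q x e)) t ->
  Q.-integrable [set: R] (EFin \o m t) /\
  forall s, Theta s -> Q.-integrable [set: R] (EFin \o m s) ->
    (1 - e) * \int[Q]_y m s y + e * m s x <=
    (1 - e) * \int[Q]_y m t y + e * m t x.
Proof.
move=> mm T0 Im0 max0 /andP[e0 e1] [Tt maxt].
have e01 : 0 <= e <= 1 by rewrite !ltW.
have contamE s : Q.-integrable [set: R] (EFin \o m s) ->
    crit (contamination Q x e) s = ((1 - e) * \int[Q]_y m s y + e * m s x)%:E.
  by move=> Is; rewrite /crit integral_contamination.
have It : Q.-integrable [set: R] (EFin \o m t).
  apply: contrapT => nIt.
  have crit_ltey : (crit Q t < +oo)%E.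
    by apply: le_lt_trans (max0 _ Tt) _; exact: integrable_lty.
  have critNy : (crit Q t = -oo)%E.
    apply/eqP; rewrite -leeNy_eq leNgt; apply/negP => critNy; apply: nIt.
    apply: (@nearby_integrable _ _ _ Q (m t) (m t) (cst 0) (mm t) (mm t)
      (integrable0 Q [set: _])) => //.
    by move=> y; rewrite subrr normr0.
  have mtN : (\int[Q]_y (EFin \o m t)^\- y = +oo)%E.
    move: critNy; rewrite /crit integralE.
    have : (0 <= \int[Q]_y (EFin \o m t)^\+ y)%E by exact: integral_ge0.
    have : (0 <= \int[Q]_y (EFin \o m t)^\- y)%E by exact: integral_ge0.
    by case: (\int[Q]_y (EFin \o m t)^\+ y)%E => //;
      case: (\int[Q]_y (EFin \o m t)^\- y)%E.
  have := maxt _ T0.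
  by rewrite contamE// /crit integral_contamination_Ny// ?e1 ?ltW// leeNy_eq.
split=> // s Ts Is.
by rewrite -lee_fin -!contamE//; exact: maxt.
Qed.

(** The domination of the derivative makes [m t - m t0] integrable. If [m t0] had
    an infinite integral, then so would [m t] for [t] near [t0], contradicting
    that [t0] maximizes strictly. *)
Lemma integrable_near_maximizer {d : measure_display} {T : measurableType d}
    {R : realType} (Q : {measure set T -> \bar R}) (m : R -> T -> R)
    (h : T -> R) (u v t0 : R) :
  `]u, v[%classic t0 -> (forall t, measurable_fun [set: T] (m t)) ->
  (forall t, `]u, v[%classic t -> t <> t0 ->
     (\int[Q]_x (m t x)%:E < \int[Q]_x (m t0 x)%:E)%E) ->
  (forall t x, `]u, v[%classic t -> derivable (m ^~ x) t 1) ->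
  Q.-integrable [set: T] (EFin \o h) ->
  (forall t x, `]u, v[%classic t -> `|derive1 (m ^~ x) t| <= h x) ->
  forall t, `]u, v[%classic t -> Q.-integrable [set: T] (EFin \o m t).
Proof.
move=> I0 mm max dm Ih mh.
have inc s t x : `]u, v[%classic s -> `]u, v[%classic t ->
    `|m s x - m t x| <= `|s - t| * h x.
  move=> Is It; rewrite mulrC.
  by apply: (@derive1_bound_increment _ (m ^~ x) u v) => // y Iy; [exact: dm|exact: mh].
have Ich (c : R) : Q.-integrable [set: T] (EFin \o (fun x => c * h x)).
  exact: (integrableZl _ c Ih).
have Im0 : Q.-integrable [set: T] (EFin \o m t0).
  pose t1 := (t0 + v) / 2.
  move: (I0); rewrite /= in_itv/= => /andP[ut0 t0v].
  have I1 : `]u, v[%classic t1 by rewrite /= in_itv/= /t1; apply/andP; split; lra.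
  have t10 : t1 <> t0 by rewrite /t1; lra.
  have lt10 := max _ I1 t10.
  apply: (@nearby_integrable _ _ _ Q (m t1) (m t0) _ (mm t1) (mm t0)
    (Ich `|t1 - t0|)); first by move=> x; exact: inc.
    exact: lt_le_trans lt10 (leey _).
  exact: le_lt_trans (leNye _) lt10.
move=> t It.
have Idiff : Q.-integrable [set: T] (EFin \o (fun x => m t0 x - m t x)).
  apply: (le_integrable _ _ _ (Ich `|t0 - t|)) => //.
    by apply/measurable_EFinP; exact: measurable_funB.
  move=> x _ /=; rewrite lee_fin [leRHS]ger0_norm; first exact: inc.
  exact: le_trans (inc t0 t x I0 It).
rewrite (_ : m t = fun x => m t0 x - (m t0 x - m t x)).
  exact: integrable_EFinB.
by apply/funext => x; lra.
Qed.

(** The classical formula - m'(t0, x) / E[m''(t0)]. Apart from local regularity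
    it rests on [t0] being a well-separated maximizer as in the premise on
    [kappa], which excludes maximizers of the contaminated criterion that stay
    away from [t0]. *)
Lemma m_estimator_influence {R : realType}
    (Q : {measure set (measurableTypeR R) -> \bar R})
    (m : R -> measurableTypeR R -> R) (Theta : set R) (t0 x : R)
    (T : {measure set (measurableTypeR R) -> \bar R} -> R)
    (crit := fun (Q' : {measure set (measurableTypeR R) -> \bar R}) s =>
       (\int[Q']_y (m s y)%:E)%E) :
  (forall t, measurable_fun [set: R] (m t)) ->
  Theta^° t0 ->
  (forall t, Theta t -> t <> t0 -> (crit Q t < crit Q t0)%E) ->
  (forall y t, Theta^° t ->
     derivable (m ^~ y) t 1 /\ derivable (derive1 (m ^~ y)) t 1) ->
  dominated_near t0 Q (fun t y => derive1 (m ^~ y) t) ->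
  dominated_near t0 Q (fun t y => derive1n 2 (m ^~ y) t) ->
  \int[Q]_y derive1n 2 (m ^~ y) t0 != 0 ->
  (Q.-integrable [set: R] (EFin \o m t0) ->
   forall delta, 0 < delta -> exists2 kappa : R, 0 < kappa & forall t, Theta t ->
     Q.-integrable [set: R] (EFin \o m t) -> delta <= `|t - t0| ->
     \int[Q]_y m t y <= \int[Q]_y m t0 y - kappa) ->
  (forall Q', argsup Theta (crit Q') !=set0 -> argsup Theta (crit Q') (T Q')) ->
  (\forall e \near 0^'+, argsup Theta (crit (contamination Q x e)) !=set0) ->
  influence_quotient T Q x e @[e --> 0^'+] -->
    - derive1 (m ^~ x) t0 / \int[Q]_y derive1n 2 (m ^~ y) t0.
Proof.
move=> mm T0i max dm [h1 Ih1 mh1] [h2 Ih2 mh2] m2_neq0 sep Targ Tdef.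
have T0 : Theta t0 by exact: interior_subset.
have : \forall t \near t0, [/\ Theta^° t,
    forall y, `|derive1 (m ^~ y) t| <= h1 y &
    forall y, `|derive1n 2 (m ^~ y) t| <= h2 y].
  near=> t; split; near: t => //.
  by apply: open_nbhs_nbhs; split => //; exact: open_interior.
move=> /near_itv[u [v [I0 uvP]]].
have uvT t : `]u, v[%classic t -> Theta t.
  by move=> /uvP[/interior_subset].
have dm1 t y : `]u, v[%classic t -> derivable (m ^~ y) t 1.
  by move=> /uvP[/(dm y)[]].
have dm2 t y : `]u, v[%classic t -> derivable (derive1 (m ^~ y)) t 1.
  by move=> /uvP[/(dm y)[]].
have b1 t y : `]u, v[%classic t -> `|derive1 (m ^~ y) t| <= h1 y.
  by move=> /uvP[].
have b2 t y : `]u, v[%classic t -> `|derive1 (derive1 (m ^~ y)) t| <= h2 y.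
  by move=> /uvP[_ _ /(_ y)].
have max_le t : Theta t -> (crit Q t <= crit Q t0)%E.
  by move=> Tt; have [->//|/eqP tt0] := eqVneq t t0; exact/ltW/max.
have Im := @integrable_near_maximizer _ _ _ Q m h1 u v t0 I0 mm
  (fun t It => max t (uvT t It)) dm1 Ih1 b1.
pose M t := \int[Q]_y m t y; pose G t := \int[Q]_y derive1 (m ^~ y) t.
have dM t : `]u, v[%classic t -> is_derive t 1 M (G t).
  by move=> It; exact: (@integral_param_derive _ _ _ Q m h1 u v).
have Im1 t : `]u, v[%classic t ->
    Q.-integrable [set: R] (EFin \o (fun y => derive1 (m ^~ y) t)).
  move=> It; apply: (le_integrable _ _ _ Ih1) => //.
    by apply/measurable_EFinP; apply: measurable_derive1_param => // y; exact: dm1.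
  by move=> y _ /=; rewrite lee_fin (le_trans (b1 t y It))// ler_norm.
have dG : is_derive t0 1 G (\int[Q]_y derive1n 2 (m ^~ y) t0).
  exact: (@integral_param_derive _ _ _ Q (fun t y => derive1 (m ^~ y) t) h2 u v).
have G'E : derive1 G t0 = \int[Q]_y derive1n 2 (m ^~ y) t0.
  by rewrite derive1E derive_val.
have [ut0 t0v] : u < t0 /\ t0 < v.
  by move: I0; rewrite /= in_itv/= => /andP.
have uv : u <= v by lra.
have critE t : Q.-integrable [set: R] (EFin \o m t) -> crit Q t = (M t)%:E.
  by move=> It; rewrite /M /Rintegral fineK//; exact: integrable_fin_num.
(* First-order condition of the uncontaminated problem. *)
have G0 : G t0 = 0.
  have M0 : is_derive t0 1 M 0.
    apply: (@derive1_at_max _ M u v) => // t It.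
      by have d := dM t It; exact: ex_derive.
    by rewrite -lee_fin -!critE ?Im//; exact/max_le/uvT.
  by have := dM t0 I0; move=> /@derive_val <-; rewrite derive_val.
have TQ : T Q = t0.
  have [TT TM] : argsup Theta (crit Q) (T Q) by apply: Targ; exists t0; split.
  apply: contrapT => /(max _ TT); apply/negP; rewrite -leNgt; exact: TM.
pose tau e := T (contamination Q x e).
have argmax : \forall e \near 0^'+, Q.-integrable [set: R] (EFin \o m (tau e)) /\
   Theta (tau e) /\ forall s, Theta s -> Q.-integrable [set: R] (EFin \o m s) ->
    (1 - e) * M s + e * m s x <= (1 - e) * M (tau e) + e * m (tau e) x.
  near=> e.
  have Ae : argsup Theta (crit (contamination Q x e)) (tau e).
    by apply: Targ; near: e; exact: Tdef.
  have e01 : 0 < e < 1.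
    apply/andP; split; near: e; first exact: nbhs_right_gt.
    exact: nbhs_right_lt.
  have [It le] :=
    contaminated_argmax Q m Theta t0 x e (tau e) mm T0 (Im _ I0) max_le e01 Ae.
  by split=> //; split=> //; case: Ae.
have taut0 : tau e @[e --> 0^'+] --> t0.
  apply: (@perturbed_argmax_cvg _
    [set t | Theta t /\ Q.-integrable [set: R] (EFin \o m t)] M (m ^~ x)).
  - by split=> //; exact: Im.
  - move=> delta delta0; have [kappa k0 far] := sep (Im _ I0) _ delta0.
    by exists kappa => // t [Tt It]; exact: far.
  - near=> e.
    have [? [? le]] : Q.-integrable [set: R] (EFin \o m (tau e)) /\
        Theta (tau e) /\
        forall s, Theta s -> Q.-integrable [set: R] (EFin \o m s) ->
      (1 - e) * M s + e * m s x <= (1 - e) * M (tau e) + e * m (tau e) x.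
      by near: e; exact: argmax.
    by split=> // t [Tt It]; exact: le.
have -> : influence_quotient T Q x = fun e => (tau e - t0) / e.
  by apply/funext => e; rewrite /influence_quotient TQ.
rewrite -G'E; apply: (@cvg_implicit_slope _ G (derive1 (m ^~ x))) => //.
- by rewrite G'E.
- by apply/differentiable_continuous/derivable1_diffP; exact: dm2.
have tauI : \forall e \near 0^'+, `]u, v[%classic (tau e).
  have nbI : nbhs t0 `]u, v[%classic.
    by apply: open_nbhs_nbhs; split=> //; exact: interval_open.
  exact: taut0 nbI.
near=> e.
have Ie : `]u, v[%classic (tau e) by near: e.
have [_ [_ le]] : Q.-integrable [set: R] (EFin \o m (tau e)) /\
    Theta (tau e) /\
    forall s, Theta s -> Q.-integrable [set: R] (EFin \o m s) ->
  (1 - e) * M s + e * m s x <= (1 - e) * M (tau e) + e * m (tau e) x.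
  by near: e; exact: argmax.
(* First-order condition of the contaminated problem at the interior
   maximizer [tau e]. *)
pose F t := (1 - e) * M t + e * m t x.
have dF t : `]u, v[%classic t ->
    is_derive t 1 F ((1 - e) * G t + e * derive1 (m ^~ x) t).
  move=> It; have dMt := dM t It.
  have dmt : is_derive t 1 (m ^~ x) (derive1 (m ^~ x) t).
    by rewrite derive1E; apply/derivableP; exact: dm1.
  exact: (is_deriveD (is_deriveZ (1 - e) dMt) (is_deriveZ e dmt)).
have F0 : is_derive (tau e) 1 F 0.
  apply: (@derive1_at_max _ F u v (tau e) uv _ Ie) => t It.
    by have d := dF t It; exact: ex_derive.
  by apply: le; [exact: uvT|exact: Im].
by have := dF _ Ie; move=> /@derive_val <-; rewrite derive_val.
Unshelve. all: by end_near. Qed.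

(** * B-robustness *)

(** Only [ln (p (x - t))] is known to be differentiable, so the density ratio is
    written as the exponential of a difference of log-densities. *)
Lemma is_derive_dlog_density_ratio {R : realType} (g : R) (p : R -> R)
    (alpha t0 x : R) :
  (forall x, 0 < p x) -> derivable (fun t => ln (p (x - t))) t0 1 ->
  is_derive t0 1 (fun t => dlog g (density_ratio p alpha t x))
    (- (density_ratio p alpha t0 x `^ g *
        derive1 (fun t => ln (p (x - t))) t0)).
Proof.
move=> p0 dl.
pose l t := ln (p (x - t)); pose c := ln (p (x - alpha)).
have rE t : density_ratio p alpha t x = expR (c - l t).
  by rewrite expRB /c /l !lnK// posrE.
have dL : is_derive t0 1 (fun t => c - l t) (- derive1 l t0).
  have hl : is_derive t0 1 l (derive1 l t0).
    by rewrite derive1E; exact/derivableP.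
  rewrite -[X in is_derive _ _ _ X]sub0r.
  exact: (is_deriveB (is_derive_cst c t0 1) hl).
have dE : is_derive t0 1 (fun t => expR (c - l t))
    (expR (c - l t0) * - derive1 l t0).
  exact: (@is_derive1_comp _ (@expR R) (fun t => c - l t) t0 _ _ _ dL).
have -> : (fun t => dlog g (density_ratio p alpha t x)) =
    dlog g \o (fun t => expR (c - l t)).
  by apply/funext => t /=; rewrite rE.
have h := is_derive_dlog g (expR (c - l t0)) (expR_gt0 _).
apply: is_derive_eq (@is_derive1_comp _ (dlog g) _ t0 _ _ h dE) _.
rewrite rE -(powRS g _ (expR_gt0 _)); ring.
Qed.

(** The integral term of [m] does not involve [x]. It is differentiable because
    it is the sum of two differentiable functions for any one [x], and its
    derivative is the constant [c]. *)
Lemma derive1_m_fun {R : realType} (g : R) (p : R -> R)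
    (P : R -> probability (measurableTypeR R) R) (alpha t0 : R) :
  (forall x, 0 < p x) ->
  (forall x, derivable (fun t => m_fun (cressie_read g) p P t alpha x) t0 1) ->
  (forall x, derivable (fun t => ln (p (x - t))) t0 1) ->
  exists c : R, forall x,
    derive1 (fun t => m_fun (cressie_read g) p P t alpha x) t0 =
    c + density_ratio p alpha t0 x `^ g *
        derive1 (fun t => ln (p (x - t))) t0.
Proof.
move=> p0 dm dl.
pose C t := \int[P alpha]_y
  (derive1 (cressie_read g) (density_ratio p alpha t y)).
pose mx x t := m_fun (cressie_read g) p P t alpha x.
have mE x : mx x = C - (fun t => dlog g (density_ratio p alpha t x)).
  by apply/funext => t; rewrite /mx m_funE.
have dr x := is_derive_dlog_density_ratio g p alpha t0 x p0 (dl x).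
have dC : derivable C t0 1.
  rewrite (_ : C = mx 0 + (fun t => dlog g (density_ratio p alpha t 0))).
    by apply: derivableD; [exact: dm|have d := dr 0; exact: ex_derive].
  by rewrite mE subrK.
exists (derive1 C t0) => x; rewrite -/(mx x) mE.
have dC' : is_derive t0 1 C (derive1 C t0) by rewrite derive1E; exact/derivableP.
have d := dr x.
rewrite [LHS]derive1E; apply: derive_val; apply: is_derive_eq.
by rewrite opprK.
Qed.

Theorem proposition5 (R : realType) (gamma : R) (p : R -> R)
  (P : R -> probability (measurableTypeR R) R) (Theta : set R)
  (alpha theta0 : R)
  (T : {measure set (measurableTypeR R) -> \bar R} -> R)
  (phi := cressie_read gamma)
  (m := m_fun phi p P)
  (* the location model *)
  (p_density : is_density p)
  (p_gt0 : forall x : R, 0 < p x)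
  (P_model : is_location_model p Theta P)
  (P_identifiable : identifiable Theta P)
  (alpha_in : Theta alpha)
  (theta0_in : Theta^° theta0)
  (* m(theta, alpha, x) is well defined *)
  (m_defined : forall theta, Theta theta ->
     (P alpha).-integrable [set: R]
       (EFin \o (fun y : measurableTypeR R =>
          derive1 phi (density_ratio p alpha theta y))))
  (* theta0 is the unique maximizer of the criterion at P theta0 *)
  (theta0_max : forall theta, Theta theta -> theta <> theta0 ->
     (criterion phi p P alpha (P theta0) theta
      < criterion phi p P alpha (P theta0) theta0)%E)
  (* standing assumptions *)
  (m_C2 : forall x : R,
     twice_continuously_differentiable Theta^° (fun theta => m theta alpha x))
  (m2_integrable : (P theta0).-integrable [set: R]
     (EFin \o (fun x : measurableTypeR R =>
        derive1n 2 (fun theta => m theta alpha x) theta0)))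
  (m2_neq0 : \int[P theta0]_(x in [set: R])
     derive1n 2 (fun theta => m theta alpha x) theta0 != 0)
  (m1_dominated : dominated_near theta0 (P theta0)
     (fun t x => derive1 (fun theta => m theta alpha x) t))
  (m2_dominated : dominated_near theta0 (P theta0)
     (fun t x => derive1n 2 (fun theta => m theta alpha x) t))
  (* T is the functional T_alpha, and it is defined at the contaminated
     measures entering the influence function *)
  (T_functional : is_dual_functional phi p P Theta alpha T)
  (T_defined : forall x : R, \forall e \near 0^'+,
     argsup Theta (criterion phi p P alpha (contamination (P theta0) x e))
       !=set0)
  (* the boundedness condition *)
  (score_derivable : forall x : R,
     derivable (fun theta => ln (p (x - theta))) theta0 1)
  (score_bounded :
     (ereal_sup (range (fun x : R =>
        `| (p (x - alpha) / p (x - theta0)) `^ gamma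
           * derive1 (fun theta => ln (p (x - theta))) theta0 |%:E)) < +oo)%E) :
  B_robust T (P theta0).
Proof.
have mp : measurable_fun [set: R] p by case: p_density.
have Theta0 : Theta theta0 by exact: interior_subset.
have m_derivable (x t : R) : Theta^° t ->
    derivable (fun s => m s alpha x) t 1 /\
    derivable (derive1 (fun s => m s alpha x)) t 1.
  by move=> Tt; have [d1 d2 _] := m_C2 x t Tt; exact: conj d1 d2.
pose V : R := \int[P theta0]_y derive1n 2 (fun t => m t alpha y) theta0.
pose m1 (x : R) : R := derive1 (fun t => m t alpha x) theta0.
have influence (x : R) :
    influence_quotient T (P theta0) x e @[e --> 0^'+] --> - m1 x / V.
  have mm t : measurable_fun [set: R] (m t alpha) by exact: measurable_m_fun.
  have sep : (P theta0).-integrable [set: R]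
      (EFin \o (m theta0 alpha : measurableTypeR R -> R)) ->
      forall delta, 0 < delta -> exists2 kappa : R, 0 < kappa &
      forall t, Theta t ->
        (P theta0).-integrable [set: R]
          (EFin \o (m t alpha : measurableTypeR R -> R)) ->
        delta <= `|t - theta0| ->
        \int[P theta0]_y m t alpha y <= \int[P theta0]_y m theta0 alpha y - kappa.
    move=> Im0 delta delta0.
    exact: (dual_criterion_separated gamma p P Theta alpha theta0 delta).
  exact: (@m_estimator_influence R (P theta0) (fun t => m t alpha) Theta theta0
    x T mm theta0_in theta0_max m_derivable m1_dominated m2_dominated m2_neq0 sep
    T_functional (T_defined x)).
split=> [x|]; first by apply/cvg_ex; eexists; exact: influence.
have [c m1E] := derive1_m_fun gamma p P alpha theta0 p_gt0
  (fun x => (m_derivable x _ theta0_in).1) score_derivable.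
have [B scoreB] : exists B : R, forall x,
    `|density_ratio p alpha theta0 x `^ gamma *
      derive1 (fun t => ln (p (x - t))) theta0| <= B.
  move: score_bounded; set S := ereal_sup _ => Sy.
  have Sub x : (`|density_ratio p alpha theta0 x `^ gamma *
      derive1 (fun t => ln (p (x - t))) theta0|%:E <= S)%E.
    by apply: ereal_sup_ubound; exists x.
  exists (fine S) => x; move: Sy (Sub x) => {Sub}.
  by case: S => [s||]//; rewrite lee_fin.
apply: (@le_lt_trans _ _ ((`|c| + B) / `|V|)%:E); last exact: ltry.
apply: ge_ereal_sup => _ [x _ <-]; rewrite lee_fin.
rewrite /influence_function (cvg_lim _ (influence x))//.
rewrite normf_div normrN ler_pM2r ?invr_gt0 ?normr_gt0//.
rewrite /m1 m1E (le_trans (ler_normD _ _))// lerD2l; exact: scoreB.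
Qed.
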